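(* Let $s\in\mathbb{N}_0$ and let $f\in C^s[0,1]$ be such that $f(0),f(1)\in\mathbb{Z}$. If \[ \|(\widetilde{B}_n(f))^{(s)}-f^{(s)}\|=o(1/n)\quad\text{or}\quad \|(\widehat{B}_n(f))^{(s)}-f^{(s)}\|=o(1/n)\qquad(n\to\infty), \] then $f(x)=px+q$ with some $p,q\in\mathbb{Z}$, and thus $\widetilde{B}_n(f)=\widehat{B}_n(f)=f$ for all $n\in\mathbb{N}_+$.
   Context: $\mathbb{N}_0=\{0,1,2,\dots\}$, $\mathbb{N}_+=\{1,2,\dots\}$; $\|\cdot\|$ is the sup-norm on $[0,1]$; $C^s[0,1]$ is the space of real-valued $s$ times continuously differentiable functions on $[0,1]$ ($C^0[0,1]=C[0,1]$), and $g^{(0)}=g$. For $f\in C[0,1]$, $x\in[0,1]$ and $n\in\mathbb{N}_+$ define \[ \widetilde{B}_n(f)(x):=\sum_{k=0}^n \left[f\left(\tfrac{k}{n}\right)\binom{n}{k}\right]x^k(1-x)^{n-k},\qquad \widehat{B}_n(f)(x):=\sum_{k=0}^n \left\langle f\left(\tfrac{k}{n}\right)\binom{n}{k}\right\rangle x^k(1-x)^{n-k}, \] where $[a]$ is the largest integer less than or equal to the real $a$, and $\langle a\rangle$ is the nearest integer to $a$; if $a=m+1/2$ with $m\in\mathbb{Z}$, then $\langle a\rangle$ is set to be either $m$ or $m+1$ (the choice may depend on whether $m$ is positive or negative, even or odd), and the result holds regardless of the choice made. *)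

(* Defs.v *)
From HB Require Import structures.
From mathcomp Require Import all_boot all_order all_algebra.
From mathcomp Require Import all_classical all_reals all_analysis.

Set Implicit Arguments.
Unset Strict Implicit.
Unset Printing Implicit Defensive.

Import Order.TTheory GRing.Theory Num.Theory.
Import numFieldNormedType.Exports.

Local Open Scope classical_set_scope.
Local Open Scope ring_scope.

(* A function on [0,1] is represented by a total function f : R -> R; every
   notion below, evaluated at points of [0,1], depends only on the values of f
   on [0,1]. *)
Section IntegerBernstein.
Context {R : realType}.
Implicit Types (f g : R -> R) (x : R).

Definition slope f x : R -> R := fun y => (f y - f x) / (y - x).

(* y tends to x with y != x and y in [0,1]: the limit of the slopes is the
   derivative at interior points, and the one-sided derivative at 0 and 1. *)
Definition nbhs01 x : set_system R := within `[0, 1] x^'.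

Definition derivable01 f x : Prop := cvg (slope f x @ nbhs01 x).

Definition deriv01 f x : R := lim (slope f x @ nbhs01 x).

Definition derivn01 (s : nat) f : R -> R := iter s deriv01 f.

Definition Cn01 (s : nat) f : Prop :=
  (forall i : nat, (i < s)%N ->
     forall x, x \in `[0, 1] -> derivable01 (derivn01 i f) x) /\
  {within `[0, 1], continuous (derivn01 s f)}.

Definition supnorm01 f : R := sup [set `|f x| | x in `[0, 1]].

(* A nearest-integer function, with ties m + 1/2 resolved arbitrarily. *)
Definition nearest_integer (rnd : R -> int) : Prop :=
  forall (a : R) (m : int), `|a - (rnd a)%:~R| <= `|a - m%:~R|.

Definition rounded_bernstein (rnd : R -> int) (n : nat) f : R -> R :=
  fun x => \sum_(k < n.+1)
    (rnd (f (k%:R / n%:R) * 'C(n, k)%:R))%:~R * x ^+ k * (1 - x) ^+ (n - k).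

Definition bernstein_floor : nat -> (R -> R) -> R -> R :=
  rounded_bernstein (@Num.floor R).

End IntegerBernstein.

(* Main.v *)
(** Let [P_n] be the rounded polynomial and [B_n] the classical Bernstein operator.
    Each [P_n] has integer coefficients, so the derivatives of [P_n] at 0 are
    integers; as they converge to those of [f], they are eventually equal to
    them, and Taylor's formula at 0 turns [(P_n - f)^(s) = o(1/n)] into
    [P_n - f = o(1/n)]. At an interior point the rounding error [P_n - B_n f] is
    exponentially small, whence [n (B_n f - f) -> 0] pointwise on ]0, 1[. By the
    parabola technique such an [f] is affine, with integer values at 0 and 1. *)

Require Import Defs.
From mathcomp Require Import all_boot all_order all_algebra.
From mathcomp Require Import all_classical all_reals all_analysis.
From mathcomp Require Import ring lra.
Import Order.TTheory GRing.Theory Num.Theory.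
Import numFieldNormedType.Exports.
Local Open Scope classical_set_scope.
Local Open Scope ring_scope.

(** * The Bernstein operator and its saturation *)

Section BernsteinOperator.
Set Implicit Arguments.
Unset Strict Implicit.
Context {R : realType}.
Implicit Types (f g : R -> R) (x : R).

Definition bern (n k : nat) x : R := 'C(n, k)%:R * x ^+ k * (1 - x) ^+ (n - k).

Definition bernstein (n : nat) f x : R :=
  \sum_(k < n.+1) f (k%:R / n%:R) * bern n k x.

Lemma bern_ge0 n k x : 0 <= x <= 1 -> 0 <= bern n k x.
Proof.
move=> /andP[x0 x1].
by rewrite /bern !mulr_ge0 ?exprn_ge0 ?ler0n ?subr_ge0.
Qed.

Lemma sum_bern n x : \sum_(k < n.+1) bern n k x = 1.
Proof.
have := exprDn (1 - x) x n; rewrite subrK expr1n => ->.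
by apply: eq_bigr => k _; rewrite /bern mulr_natl mulrnAl mulrC.
Qed.

(** Absorption identity [k C(n+1, k) = (n+1) C(n, k-1)]: each factor [k] lowers the degree by one,
    which yields the binomial moments. *)
Lemma sum_natr_bern n (g : nat -> R) x :
  \sum_(k < n.+2) k%:R * g k * bern n.+1 k x =
  n.+1%:R * x * \sum_(k < n.+1) g k.+1 * bern n k x.
Proof.
rewrite big_ord_recl/= !mul0r add0r mulr_sumr; apply: eq_bigr => k _.
have /(congr1 (fun m => m%:R : R)) := mul_bin_diag n.+1 k.
rewrite /= !natrM => E.
rewrite /bern /bump /= add1n subSS exprS.
transitivity (g k.+1 * (k.+1%:R * 'C(n.+1, k.+1)%:R) * x * x ^+ k
    * (1 - x) ^+ (n - k)).
  by ring.
by rewrite -E; ring.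
Qed.

(** Moments of order at most 2 of the binomial law. The exact term [x (1 - x) / n] drives both the
    convergence and the saturation argument. *)
Lemma bernstein_poly2 n (a b c : R) x : (0 < n)%N ->
  bernstein n (fun t => a + b * t + c * t ^+ 2) x =
  a + b * x + c * (x ^+ 2 + x * (1 - x) / n%:R).
Proof.
case: n => // n _; set N : R := n.+1%:R.
have N0 : N != 0 by rewrite pnatr_eq0.
transitivity (a * \sum_(k < n.+2) bern n.+1 k x
  + b / N * \sum_(k < n.+2) k%:R * 1 * bern n.+1 k x
  + c / N ^+ 2 * \sum_(k < n.+2) k%:R * k%:R * bern n.+1 k x).
  rewrite !mulr_sumr -!big_split/=; apply: eq_bigr => k _.
  by rewrite -/N; field.
rewrite sum_bern (sum_natr_bern n (fun=> 1)) (sum_natr_bern n (fun k => k%:R)).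
under eq_bigr do rewrite mul1r.
rewrite sum_bern.
have -> : \sum_(k < n.+1) k.+1%:R * bern n k x = n%:R * x + 1.
  under eq_bigr => k _ do rewrite -natr1 mulrDl mul1r.
  rewrite big_split/= sum_bern; congr (_ + _).
  (* The absorption identity starts from a positive degree, so degree 0 is treated apart. *)
  case: n {N N0} => [|n]; first by rewrite big_ord1 !mul0r.
  have := sum_natr_bern n (fun=> 1) x.
  under [in RHS]eq_bigr do rewrite mul1r.
  rewrite sum_bern mulr1 => <-.
  by apply: eq_bigr => k _; rewrite mulr1.
have -> : n%:R = N - 1 by rewrite /N -natr1 addrK.
by rewrite -/N; field.
Qed.

(** With [d = 0] this evaluates a quadratic, with [d = 1] a quadratic perturbation of [f]; both
    cases occur below. *)
Lemma bernstein_linear n f x (a b c d : R) : (0 < n)%N ->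
  bernstein n (fun t => d * f t + (a + b * t + c * t ^+ 2)) x =
  d * bernstein n f x + (a + b * x + c * (x ^+ 2 + x * (1 - x) / n%:R)).
Proof.
move=> n0; rewrite -(bernstein_poly2 _ _ _ _ n0) /bernstein mulr_sumr -big_split/=.
by apply: eq_bigr => k _; rewrite mulrDl mulrA.
Qed.

Lemma node01 n k : (k <= n)%N -> 0 <= (k%:R / n%:R : R) <= 1.
Proof.
move=> kn; rewrite divr_ge0 ?ler0n//=.
(* For [n = 0] the node is 0, since the inverse of 0 is 0. *)
case: n kn => [|n] kn; first by rewrite invr0 mulr0.
by rewrite ler_pdivrMr ?ltr0n// mul1r ler_nat.
Qed.

Lemma bernstein_le n f g x : (forall t, 0 <= t <= 1 -> f t <= g t) ->
  0 <= x <= 1 -> bernstein n f x <= bernstein n g x.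
Proof.
move=> fg x01; apply: ler_sum => k _.
by apply: ler_wpM2r; [exact: bern_ge0|apply/fg/node01; rewrite -ltnS].
Qed.

Lemma continuous01P f : {within `[0, 1], continuous f} <->
  (forall x, 0 <= x <= 1 -> forall e, 0 < e ->
    exists2 d, 0 < d & forall t, 0 <= t <= 1 -> `|x - t| < d -> `|f x - f t| <= e).
Proof.
rewrite subspace_continuousP; split.
  move=> fc x x01 e e0.
  have /fc/cvgrPdist_le/(_ e e0) : `[0, 1]%classic x by rewrite /= in_itv.
  rewrite /within /= => /nbhs_ballP[d /= d0 H].
  by exists d => // t t01 xt; apply: H; rewrite //= in_itv.
move=> H x /=; rewrite in_itv /= => x01; apply/cvgrPdist_le => e e0.
have [d d0 K] := H x x01 e e0.
rewrite /within /=; apply/nbhs_ballP; exists d => //= t xt.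
by rewrite in_itv /= => t01; exact: K.
Qed.

Lemma continuous01_bounded f : {within `[0, 1], continuous f} ->
  exists2 K, 0 < K & forall x, 0 <= x <= 1 -> `|f x| <= K.
Proof.
move=> fc.
have /compact_bounded/pinfty_ex_gt0[K K0 H] :=
  continuous_compact fc (@segment_compact _ (0 : R) 1).
exists K => // x x01; apply: H; exists x => //; rewrite /= in_itv.
Qed.

(* Chebyshev's argument: |f t - f x| <= e + (2K/d^2)(t-x)^2 on [0,1]. *)
Lemma bernstein_cvg f x : {within `[0, 1], continuous f} -> 0 <= x <= 1 ->
  bernstein n f x @[n --> \oo] --> f x.
Proof.
move=> fc x01; apply/cvgrPdist_le => e e0.
have [K K0 fK] := continuous01_bounded fc.
have e20 : 0 < e / 2 by lra.
have [d d0 fd] := (continuous01P f).1 fc x x01 _ e20.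
pose L := 2 * K / d ^+ 2.
have L0 : 0 < L by rewrite /L divr_gt0 ?exprn_gt0// mulr_gt0.
have key t : 0 <= t <= 1 -> `|f x - f t| <= e / 2 + L * (t - x) ^+ 2.
  move=> t01; have [xt|xt] := ltP `|x - t| d.
    have := fd t t01 xt; have : 0 <= L * (t - x) ^+ 2.
      by rewrite mulr_ge0 ?sqr_ge0// ltW.
    lra.
  have : `|f x - f t| <= 2 * K.
    by have := ler_normB (f x) (f t); have := fK x x01; have := fK t t01; lra.
  have : 2 * K <= L * (t - x) ^+ 2.
    rewrite /L mulrAC ler_pdivlMr ?exprn_gt0//.
    rewrite ler_pM2l ?mulr_gt0// -[leRHS]real_normK ?num_real//.
    by rewrite distrC lerXn2r // nnegrE ltW.
  lra.
have bnd n : (0 < n)%N ->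
    `|f x - bernstein n f x| <= e / 2 + L * (x * (1 - x) / n%:R).
  move=> n0.
  (* The parabola [f x + e / 2 + L (t - x)^2], expanded in [t]; the null term in [f t] fits it to
     [bernstein_linear]. *)
  have /bernstein_le-/(_ n x x01) U : forall t, 0 <= t <= 1 -> f t <=
      0 * f t + ((f x + e / 2 + L * x ^+ 2) + (- 2 * L * x) * t + L * t ^+ 2).
    move=> t t01; have := key t t01; rewrite ler_norml => /andP[A B].
    by rewrite mul0r add0r; lra.
  have /bernstein_le-/(_ n x x01) V : forall t, 0 <= t <= 1 ->
      0 * f t + ((f x - e / 2 - L * x ^+ 2) + (2 * L * x) * t + (- L) * t ^+ 2)
      <= f t.
    move=> t t01; have := key t t01; rewrite ler_norml => /andP[A B].
    by rewrite mul0r add0r; lra.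
  rewrite bernstein_linear// in U; rewrite bernstein_linear// in V.
  rewrite mul0r add0r in U; rewrite mul0r add0r in V.
  move: U V; set u := x * (1 - x) / _ => U V.
  by rewrite ler_norml; apply/andP; split; lra.
near=> n.
have n0 : (0 < n)%N by near: n; exact: nbhs_infty_gt.
apply: (le_trans (bnd n n0)).
have : L * (x * (1 - x) / n%:R) <= L / n%:R.
  rewrite mulrA ler_wpM2r ?invr_ge0// ler_piMr//; first exact: ltW.
  by move/andP: x01 => [? ?]; nra.
have : L / n%:R <= e / 2.
  rewrite ler_pdivrMr ?ltr0n// mulrC -ler_pdivrMr//.
  by near: n; exact: nbhs_infty_ger.
lra.
Unshelve. all: end_near. Qed.

(* If [f] minus its chord is positive somewhere, adding [e t^2] with [e] small
   keeps an interior maximum [x], where the positivity of the operator gives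
   [n (B_n f x - f x) <= - e x (1 - x)]. *)
Lemma bernstein_saturation_le f : {within `[0, 1], continuous f} ->
  (forall x, 0 < x < 1 -> n%:R * (bernstein n f x - f x) @[n --> \oo] --> 0) ->
  forall x, 0 <= x <= 1 -> f x <= f 0 + (f 1 - f 0) * x.
Proof.
move=> fc fo y y01; rewrite leNgt; apply/negP => fy.
(* Half the excess of [f] over its chord at [y]: [h] is then 0 and [e] at the endpoints but at least
   [2 e] at [y], so its maximum is interior. *)
pose e := (f y - (f 0 + (f 1 - f 0) * y)) / 2.
have e0 : 0 < e by rewrite /e; lra.
pose h t := 1 * f t + (- f 0 + (f 0 - f 1) * t + e * t ^+ 2).
have hc : {within `[0, 1], continuous h}.
  have pc : {within `[0, 1], continuous (fun t : R =>
      - f 0 + (f 0 - f 1) * t + e * t ^+ 2)}.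
    have -> : (fun t : R => - f 0 + (f 0 - f 1) * t + e * t ^+ 2) =
        horner ((- f 0)%:P + (f 0 - f 1)%:P * 'X + e%:P * 'X ^+ 2).
      by apply/funext => t; rewrite !hornerE.
    by apply: continuous_subspaceT => t; exact: continuous_horner.
  move=> z; apply: cvgD; last exact: pc.
  by apply: cvgM; [exact: cvg_cst|exact: fc].
have [x xI hmax] := EVT_max ler01 hc.
have x01 : 0 <= x <= 1 by move: xI; rewrite in_itv.
have hyx : h y <= h x by apply: hmax; rewrite in_itv.
have hy : 2 * e <= h y.
  by rewrite /h mul1r; have := sqr_ge0 y; rewrite /e; nra.
have xi : 0 < x < 1.
  have [x0 x1] := andP x01; rewrite !lt_neqAle x0 x1 !andbT.
  have h0 : h 0 = 0 by rewrite /h; ring.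
  have h1 : h 1 = e by rewrite /h; ring.
  apply/andP; split; apply/eqP => xE; move: hyx hy.
    by rewrite -xE h0; lra.
  by rewrite xE h1; lra.
have c0 : 0 < e * (x * (1 - x)).
  by move: xi => /andP[? ?]; rewrite !mulr_gt0 ?subr_gt0.
have /cvgrPdist_lt/(_ _ c0)[N _ H] := fo x xi.
have {H} := H N.+1 (leqnSn N); rewrite sub0r normrN.
(* The constant [h x] dominates [h]; it is written as a degenerate quadratic so that
   [bernstein_linear] evaluates both sides. *)
have /bernstein_le-/(_ N.+1 x x01) : forall t, 0 <= t <= 1 ->
    h t <= 0 * f t + (h x + 0 * t + 0 * t ^+ 2).
  by move=> t t01; have := hmax t; rewrite in_itv /= => /(_ t01); lra.
rewrite !bernstein_linear//.
rewrite /h; set B := bernstein _ _ _; set n : R := N.+1%:R => H.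
rewrite ltr_norml => /andP[+ _]; apply/negP; rewrite -leNgt.
have n0 : 0 < n by rewrite ltr0n.
have {H} : B - f x <= - (e * (x * (1 - x) / n)) by move: H; set u := _ / n; lra.
rewrite -(ler_pM2l n0) => /le_trans; apply.
by rewrite le_eqVlt; apply/orP; left; apply/eqP; field; rewrite gt_eqF.
Qed.

(** The one-sided bound is applied to [f] and to [- f]. *)
Lemma bernstein_saturation f : {within `[0, 1], continuous f} ->
  (forall x, 0 < x < 1 -> n%:R * (bernstein n f x - f x) @[n --> \oo] --> 0) ->
  forall x, 0 <= x <= 1 -> f x = f 0 + (f 1 - f 0) * x.
Proof.
move=> fc fo x x01; apply/eqP; rewrite eq_le bernstein_saturation_le//=.
have := @bernstein_saturation_le (fun t => - f t) _ _ x x01.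
rewrite (_ : - f 0 + _ = - (f 0 + (f 1 - f 0) * x)); last by ring.
rewrite lerN2; apply; first by move=> z; apply: cvgN; exact: fc.
move=> z z01; rewrite -oppr0.
under eq_fun => n.
  rewrite (_ : _ * _ = - (n%:R * (bernstein n f z - f z))); last first.
    rewrite -mulrN opprB; congr (_ * _); rewrite /bernstein opprK addrC.
    by congr (_ + _); rewrite -sumrN; apply: eq_bigr => k _; rewrite mulNr.
  over.
by apply: cvgN; exact: fo.
Qed.

End BernsteinOperator.

(** * One-sided derivatives on [[0, 1]] *)

Section OneSidedDerivatives.
Set Implicit Arguments.
Unset Strict Implicit.
Context {R : realType}.
Implicit Types (f g h : R -> R) (x : R) (p : {poly R}).

Lemma nbhs01P x (A : set R) : nbhs01 x A <->
  exists2 d, 0 < d &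
    forall y, 0 <= y <= 1 -> y != x -> `|x - y| < d -> A y.
Proof.
rewrite /nbhs01 /within /dnbhs /= /within /=; split.
  move=> /nbhs_ballP[d /= d0 H]; exists d => // y y01 yx xy.
  by apply: H => //=; rewrite in_itv.
move=> [d d0 H]; apply/nbhs_ballP; exists d => //= y xy yx.
by rewrite in_itv /= => y01; exact: H.
Qed.

#[local] Instance nbhs01_filter x : Filter (nbhs01 x).
Proof. exact: within_filter. Qed.

(** Properness makes limits along [nbhs01 x] unique. A small step from [x] towards the farther
    endpoint stays in the interval, even when [x] is 0 or 1. *)
Lemma nbhs01_proper x : 0 <= x <= 1 -> ProperFilter (nbhs01 x).
Proof.
move=> x01; apply: Build_ProperFilter_ex => A /nbhs01P[d d0 H].
have [xh|xh] := leP x (1 / 2).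
  pose e := Num.min d 1 / 3.
  have /andP[e0 ed] : 0 < e < d.
    by rewrite /e; case: (ltP d 1) => ?; lra.
  have e1 : e <= 1 / 3 by rewrite /e; case: (ltP d 1) => ?; lra.
  exists (x + e); apply: (H (x + e)); first by move: x01; lra.
    by rewrite gt_eqF// ltrDl.
  by rewrite opprD addNKr normrN gtr0_norm.
pose e := Num.min d 1 / 3.
have /andP[e0 ed] : 0 < e < d.
  by rewrite /e; case: (ltP d 1) => ?; lra.
have e1 : e <= 1 / 3 by rewrite /e; case: (ltP d 1) => ?; lra.
exists (x - e); apply: (H (x - e)); first by move: x01; lra.
  by rewrite lt_eqF// ltrBlDr ltrDl.
by rewrite opprB addrC subrK gtr0_norm.
Qed.

(** Relational form of the derivative: [derivable01 f x] unfolds to [has_deriv01 f x (deriv01 f x)],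
    so no default value of [lim] intervenes. *)
Definition has_deriv01 f x (d : R) : Prop := slope f x @ nbhs01 x --> d.

Lemma has_deriv01P f x (d : R) : has_deriv01 f x d <->
  forall e, 0 < e -> exists2 r, 0 < r & forall y, 0 <= y <= 1 -> y != x ->
    `|x - y| < r -> `|d - slope f x y| <= e.
Proof.
rewrite /has_deriv01; split=> [/cvgrPdist_le H e e0|H].
  by have /nbhs01P := H e e0.
by apply/cvgrPdist_le => e e0; apply/nbhs01P; exact: H.
Qed.

Lemma has_deriv01_lim f x (d : R) : 0 <= x <= 1 -> has_deriv01 f x d ->
  deriv01 f x = d.
Proof.
by move=> /nbhs01_proper x01 fd; apply/cvg_lim.
Qed.

Lemma has_deriv01_eq f g x (d : R) : 0 <= x <= 1 ->
  (forall y, 0 <= y <= 1 -> f y = g y) -> has_deriv01 f x d ->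
  has_deriv01 g x d.
Proof.
move=> x01 fg /has_deriv01P H; apply/has_deriv01P => e /H[r r0 K].
by exists r => // y y01 yx xy; rewrite /slope -!fg//; exact: K.
Qed.

Lemma has_deriv01B f g x (c d : R) : has_deriv01 f x c -> has_deriv01 g x d ->
  has_deriv01 (fun y => f y - g y) x (c - d).
Proof.
move=> fc gd; rewrite /has_deriv01.
rewrite (_ : slope _ x = fun y => slope f x y - slope g x y); first exact: cvgB.
by apply/funext => y; rewrite /slope -mulrBl; congr (_ / _); ring.
Qed.

(** Factor [p - p(x) = q (X - x)]: off [x] the slope is the continuous [q], and [p'(x) = q(x)].
    Endpoints are covered by the same argument. *)
Lemma has_deriv01_poly p x : has_deriv01 (horner p) x p^`().[x].
Proof.
have /factor_theorem[q pq] : root (p - p.[x]%:P) x.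
  by rewrite rootE !hornerE subrr.
have -> : p^`().[x] = q.[x].
  have := congr1 deriv pq; rewrite derivB derivC subr0 => ->.
  by rewrite derivM derivXsubC !hornerE subrr mulr0 add0r.
have /cvgrPdist_le qc := @continuous_horner R q x.
apply/has_deriv01P => e /qc/nbhs_ballP[r /= r0 H]; exists r => // y _ yx xy.
rewrite (_ : slope _ x y = q.[y]); first exact: H.
have := congr1 (horner^~ y) pq; rewrite /slope !hornerE => ->.
by rewrite mulfK// subr_eq0.
Qed.

Lemma has_deriv01_continuous h (dh : R -> R) :
  (forall x, 0 <= x <= 1 -> has_deriv01 h x (dh x)) ->
  {within `[0, 1], continuous h}.
Proof.
move=> H; apply/subspace_continuousP => x /=; rewrite in_itv /= => x01.
apply/cvgrPdist_le => e e0; rewrite /within /=.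
have /has_deriv01P/(_ 1 ltr01)[r r0 K] := H x x01.
(* Slopes from [x] to nearby points are bounded by [M], whence [|h x - h y| <= M |x - y|] there. *)
pose M := `|dh x| + 1; have M0 : 0 < M by rewrite /M ltr_wpDl.
apply/nbhs_ballP; exists (Num.min r (e / M)) => /=.
  by rewrite lt_min r0 divr_gt0.
move=> y; rewrite /ball /= lt_min => /andP[xy1 xy2]; rewrite in_itv /= => y01.
have [->|yx] := eqVneq y x; first by rewrite subrr normr0 ltW.
have /K : 0 <= y <= 1 by [].
move=> /(_ yx xy1) S.
have S' : `|slope h x y| <= M.
  rewrite /M; have := ler_normB (dh x) (dh x - slope h x y).
  by rewrite subKr; lra.
have -> : h x - h y = slope h x y * (x - y).
  by rewrite /slope -[x - y]opprB mulrN divfK ?subr_eq0// opprB.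
rewrite normrM -(@divfK _ M _ e) ?gt_eqF// mulrC.
by rewrite ler_pM// ltW.
Qed.

(** Small increments from an interior point stay in the interval, so the ordinary derivative is
    recovered and the mean value theorem becomes available. *)
Lemma has_deriv01_is_derive h x (d : R) : 0 < x < 1 -> has_deriv01 h x d ->
  is_derive x (1 : R) h d.
Proof.
move=> /andP[x0 x1] /has_deriv01P H.
suff K : (fun t : R => t^-1 *: ((h \o shift x) (t *: (1 : R)) - h x)) @ 0^' --> d.
  apply: DeriveDef; last exact/cvg_lim.
  by apply/cvg_ex; exists d.
apply/cvgrPdist_le => e /H[r r0 K].
rewrite /dnbhs /within /=; apply/nbhs_ballP.
exists (Num.min r (Num.min x (1 - x))) => /=; first by rewrite !lt_min; lra.
move=> t; rewrite /ball /= sub0r normrN !lt_min => /and3P[tr tx t1] t0.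
have := K (t + x); rewrite /slope addrK [_ *: 1]mulr1 [_^-1 *: _]mulrC; apply.
- by move: tx t1; rewrite !ltr_norml; lra.
- by rewrite -subr_eq0 addrK.
- by rewrite opprD addrCA subrr addr0 normrN.
Qed.

(** Mean value theorem on [[0, x]], whose length is at most 1. *)
Lemma has_deriv01_bound h (dh : R -> R) (M : R) :
  (forall x, 0 <= x <= 1 -> has_deriv01 h x (dh x)) ->
  (forall x, 0 <= x <= 1 -> `|dh x| <= M) ->
  forall x, 0 <= x <= 1 -> `|h x - h 0| <= M.
Proof.
move=> hd hM x /andP[x0 x1].
have hc := has_deriv01_continuous hd.
have [||c cx ->] := @MVT_segment R h dh 0 x x0.
- move=> y; rewrite in_itv /= => /andP[y0 yx].
  by apply: has_deriv01_is_derive; [lra|apply: hd; lra].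
- apply: continuous_subspaceW hc => y /=; rewrite !in_itv /=; lra.
move: cx; rewrite in_itv /= => c0x; rewrite subr0 normrM (ger0_norm x0).
have dM : `|dh c| <= M by apply: hM; lra.
by apply: le_trans dM; rewrite ler_piMr.
Qed.

(** Induction on [s]: the Taylor remainder vanishes at 0, and its derivative is the remainder of the
    shifted family. On an interval of length 1 the bound [M] passes unchanged from one order to the
    next. *)
Lemma taylor01 (D : nat -> R -> R) s (M : R) :
  (forall i x, (i < s)%N -> 0 <= x <= 1 -> has_deriv01 (D i) x (D i.+1 x)) ->
  (forall x, 0 <= x <= 1 -> `|D s x| <= M) ->
  forall x, 0 <= x <= 1 ->
    `|D 0%N x - \sum_(i < s) D i 0 / i`!%:R * x ^+ i| <= M.
Proof.
elim: s D => [|s IH] D HD HM x x01; first by rewrite big_ord0 subr0; exact: HM.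
pose T : {poly R} := \poly_(i < s.+1) (D i 0 / i`!%:R).
have TE y : T.[y] = \sum_(i < s.+1) D i 0 / i`!%:R * y ^+ i.
  by rewrite horner_poly.
have T'E y : T^`().[y] = \sum_(i < s) D i.+1 0 / i`!%:R * y ^+ i.
  rewrite (_ : T^`() = \poly_(i < s) (D i.+1 0 / i`!%:R)) ?horner_poly//.
  apply/polyP => i; rewrite coef_deriv !coef_poly ltnS; case: ifP => _.
    rewrite -[LHS]mulr_natr factS natrM invfM -!mulrA; congr (_ * _).
    by rewrite mulrCA mulVf ?mulr1// pnatr_eq0.
  by rewrite mul0rn.
have := @has_deriv01_bound (fun y => D 0%N y - T.[y])
  (fun y => D 1%N y - T^`().[y]) M.
move=> /(_ _ _ x x01).
have T0 : D 0%N 0 - T.[0] = 0.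
  rewrite TE big_ord_recl /= expr0 fact0 invr1 !mulr1 big1 ?addr0 ?subrr//.
  by move=> i _; rewrite expr0n /= mulr0.
rewrite T0 subr0 TE; apply.
  by move=> y y01; apply: has_deriv01B; [exact: HD|exact: has_deriv01_poly].
move=> y y01; rewrite T'E.
by apply: (IH (fun i => D i.+1)) => // i z iz z01; exact: HD.
Qed.

Lemma derivn01_poly p f s x : (forall y, 0 <= y <= 1 -> f y = p.[y]) ->
  0 <= x <= 1 -> derivn01 s f x = p^`(s).[x].
Proof.
move=> fp; elim: s x => [|s IH] x x01 /=; first by rewrite fp.
apply: has_deriv01_lim => //.
have := @has_deriv01_poly p^`(s) x; rewrite -derivnS.
apply: has_deriv01_eq => // y y01.
by rewrite IH.
Qed.

Lemma Cn01_continuous s f : Cn01 s f -> {within `[0, 1], continuous f}.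
Proof.
case: s => [[] //|s] [H _].
apply: (@has_deriv01_continuous _ (derivn01 1 f)) => x x01.
by apply: (H 0%N) => //; rewrite in_itv.
Qed.

(** The supremum of an unbounded set is a default value; the bound [K] makes it a genuine
    supremum. *)
Lemma ler_supnorm01 h (K : R) : (forall x, 0 <= x <= 1 -> `|h x| <= K) ->
  forall x, 0 <= x <= 1 -> `|h x| <= supnorm01 h.
Proof.
move=> hK x x01; apply: sup_upper_bound; last first.
  by exists x => //=; rewrite in_itv.
split; first by exists `|h x|, x => //=; rewrite in_itv.
by exists K => _ [y /= + <-]; rewrite in_itv /=; exact: hK.
Qed.

End OneSidedDerivatives.

(** * Rounded Bernstein polynomials *)

Section IntegerCoefficients.
Set Implicit Arguments.
Unset Strict Implicit.
Context {R : realType}.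
Implicit Types (f : R -> R) (x : R) (rnd : R -> int).

Lemma cvgn_ext (u v : nat -> R) (l : R) : u =1 v ->
  u @ \oo --> l -> v @ \oo --> l.
Proof. by move=> /funext ->. Qed.

(** [q^n] is the least of the [n + 1] terms of a geometric sum that is at most [1 / (1 - q)]. *)
Lemma natr_exprn_bounded (q : R) n : 0 <= q < 1 ->
  n.+1%:R * q ^+ n <= (1 - q)^-1.
Proof.
move=> /andP[q0 q1].
have q10 : 0 < 1 - q by rewrite subr_gt0.
rewrite -[leRHS]mul1r ler_pdivlMr//.
apply: (@le_trans _ _ ((\sum_(i < n.+1) q ^+ i) * (1 - q))).
  have -> : n.+1%:R * q ^+ n = \sum_(i < n.+1) q ^+ n.
    by rewrite sumr_const card_ord mulr_natl.
  apply: ler_wpM2r; first exact: ltW.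
  by apply: ler_sum => i _; apply: ler_wiXn2l => //; rewrite ?ltW// -ltnS.
have := subrX1 q n.+1; have := exprn_ge0 n.+1 q0; set S := \sum_(i < _) _.
by move=> ? E; rewrite -[1 - q]opprB mulrN mulrC -E opprB; lra.
Qed.

(** Choose [q < 1] with [M <= q^3]: two of the three factors [q^n] absorb [n] and [n + 1], and the
    third tends to 0. *)
Lemma cvg_sqr_geometric (M : R) : 0 <= M < 1 ->
  n%:R * (n.+1%:R * M ^+ n) @[n --> \oo] --> 0.
Proof.
move=> /andP[M0 M1]; pose q := 1 - (1 - M) / 3; pose C := (1 - q)^-1.
have q01 : 0 <= q < 1 by rewrite /q; lra.
have /andP[q0 q1] := q01.
(* As [M = 1 - 3 (1 - q)], this is Bernoulli's inequality. *)
have Mq : M <= q ^+ 3.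
  have -> : q ^+ 3 = M + (1 - q) ^+ 2 * (2 + q) by rewrite /q; field.
  by rewrite lerDl mulr_ge0 ?sqr_ge0//; lra.
have C0 : 0 <= C by rewrite invr_ge0 subr_ge0 ltW.
have gq : (C * C) * q ^+ n @[n --> \oo] --> 0.
  by have := @cvg_geometric R (C * C) q; rewrite ger0_norm//; apply.
apply: (squeeze_cvgr _ (cvg_cst 0) gq); near=> n.
rewrite !mulr_ge0 ?exprn_ge0//=.
have B := natr_exprn_bounded n q01; rewrite -/C in B.
have Mn : M ^+ n <= q ^+ n * q ^+ n * q ^+ n.
  by rewrite -!exprMn -expr2 -exprSr; apply: lerXn2r; rewrite ?nnegrE ?exprn_ge0.
have nn : n%:R <= n.+1%:R :> R by rewrite ler_nat.
have N0 : 0 <= n%:R :> R by [].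
have qn0 := exprn_ge0 n q0.
apply: (@le_trans _ _ (n.+1%:R * (n.+1%:R * (q ^+ n * q ^+ n * q ^+ n)))).
  by apply: ler_pM => //; [rewrite mulr_ge0 ?exprn_ge0|rewrite ler_wpM2l].
rewrite (_ : n.+1%:R * _ =
  ((n.+1%:R * q ^+ n) * (n.+1%:R * q ^+ n)) * q ^+ n); last by ring.
by rewrite ler_wpM2r// ler_pM// mulr_ge0.
Unshelve. all: end_near. Qed.

(** Each of the [n + 1] coefficients is off by at most 1, and [x^k (1 - x)^(n - k)] is at most
    [M^n]. *)
Lemma rounded_bernstein_dist rnd n f x (M : R) :
  (forall a, `|a - (rnd a)%:~R| <= 1) -> 0 <= x <= 1 -> x <= M -> 1 - x <= M ->
  `|rounded_bernstein rnd n f x - bernstein n f x| <= n.+1%:R * M ^+ n.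
Proof.
move=> hr /andP[x0 x1] xM x1M; rewrite -sumrB.
apply: (le_trans (ler_norm_sum _ _ _)).
have -> : n.+1%:R * M ^+ n = \sum_(k < n.+1) M ^+ n.
  by rewrite sumr_const card_ord mulr_natl.
apply: ler_sum => k _.
set a := f _.
have -> : (rnd (a * 'C(n, k)%:R))%:~R * x ^+ k * (1 - x) ^+ (n - k)
    - a * bern n k x = - (a * 'C(n, k)%:R - (rnd (a * 'C(n, k)%:R))%:~R)
    * (x ^+ k * (1 - x) ^+ (n - k)) by rewrite /bern; ring.
have kn : (k <= n)%N by rewrite -ltnS.
have y0 : 0 <= 1 - x by rewrite subr_ge0.
rewrite normrM normrN (ger0_norm (mulr_ge0 (exprn_ge0 _ x0) (exprn_ge0 _ y0))).
rewrite -[leRHS]mul1r -[in leRHS](subnKC kn) exprD.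
apply: ler_pM => //; first by rewrite mulr_ge0 ?exprn_ge0.
have M0 : 0 <= M by exact: le_trans xM.
by apply: ler_pM; rewrite ?exprn_ge0//; apply: lerXn2r; rewrite ?nnegrE.
Qed.

Lemma rounded_bernstein_cvg rnd f x : (forall a, `|a - (rnd a)%:~R| <= 1) ->
  0 < x < 1 ->
  n%:R * (rounded_bernstein rnd n f x - bernstein n f x) @[n --> \oo] --> 0.
Proof.
move=> hr /andP[x0 x1]; pose M := Num.max x (1 - x).
have M01 : 0 <= M < 1 by rewrite /M le_max ltW//= gt_max x1 ltrBlDr ltrDl.
have /cvgrPdist_le H := cvg_sqr_geometric M01.
apply/cvgrPdist_le => e /H; apply: filterS => n.
rewrite !sub0r !normrN; apply: le_trans.
rewrite 2!normrM ler_wpM2l// [leRHS]ger0_norm; last first.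
  by rewrite mulr_ge0// exprn_ge0//; case/andP: M01.
apply: rounded_bernstein_dist => //.
- by rewrite !ltW.
- by rewrite /M le_max lexx.
- by rewrite /M le_max lexx orbT.
Qed.

(** Integer coefficients in the monomial basis make all derivatives at 0 integers. *)
Lemma rounded_bernstein_poly rnd n f : exists p : {poly int},
  forall x, rounded_bernstein rnd n f x = (map_poly intr p).[x].
Proof.
exists (\sum_(k < n.+1) (rnd (f (k%:R / n%:R) * 'C(n, k)%:R))%:P
  * 'X ^+ k * (1 - 'X) ^+ (n - k)) => x.
rewrite rmorph_sum horner_sum; apply: eq_bigr => k _.
by rewrite !rmorphM/= !rmorphXn/= rmorphB/= rmorph1 map_polyC map_polyX !hornerE.
Qed.

(** Two terms within 1/3 of the limit differ by an integer smaller than 1 in absolute value, so the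
    sequence is eventually constant. *)
Lemma int_cvg_eq (m : nat -> R) (c : R) : (forall n, m n \is a Num.int) ->
  m @ \oo --> c -> \forall n \near \oo, m n = c.
Proof.
move=> mI mc; have /cvgrPdist_lt/(_ (1 / 3)) := mc.
case=> [|N _ H]; first by lra.
have mN n : (N <= n)%N -> m n = m N.
  move=> Nn; apply/eqP; rewrite -subr_eq0; apply/negPn/negP => ne.
  have : 1 <= `|m n - m N| by apply: norm_intr_ge1 => //; rewrite rpredB.
  apply/negP; rewrite -ltNge.
  have := H n Nn; have := H N (leqnn N); rewrite /= !ltr_norml; lra.
have cN : c = m N.
  apply: (cvg_unique _ mc) => //.
  apply: cvg_near_cst; exists N => // n /= Nn; exact: mN.
by exists N => // n /= /mN ->.
Qed.

(* [Q x - 2^k Q (x/2)] has degree less than [k] when [Q] has degree [k]. *)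
Lemma coef_cvg0 k (a : nat -> nat -> R) :
  (forall x, 0 < x < 1 -> \sum_(i < k) a n i * x ^+ i @[n --> \oo] --> 0) ->
  forall i, (i < k)%N -> a n i @[n --> \oo] --> 0.
Proof.
elim: k a => // k IH a H.
(* This factor multiplies the coefficient of degree [i] once the top degree has cancelled; being
   nonzero, it can be divided out. *)
have lt2X i : (i < k)%N -> 1 - 2 ^+ k / 2 ^+ i != 0 :> R.
  move=> ik; rewrite subr_eq0 eq_sym -(subnKC (ltnW ik)) exprD mulrC.
  rewrite mulKf ?expf_neq0//.
  by rewrite gt_eqF// exprn_egt1 ?ltr1n// -lt0n subn_gt0.
have lower i : (i < k)%N -> a n i @[n --> \oo] --> 0.
  move=> ik.
  have W : a n i * (1 - 2 ^+ k / 2 ^+ i) @[n --> \oo] --> 0.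
    apply: (IH (fun n i => a n i * (1 - 2 ^+ k / 2 ^+ i))) ik => x x01.
    have x01' : 0 < x / 2 < 1 by lra.
    have : \sum_(i < k.+1) a n i * x ^+ i -
        2 ^+ k * (\sum_(i < k.+1) a n i * (x / 2) ^+ i)
        @[n --> \oo] --> (0 - 2 ^+ k * 0 : R).
      by apply: cvgB (H x x01) _; apply: cvgM (cvg_cst _) (H (x / 2) x01').
    rewrite mulr0 subr0; apply: cvgn_ext => n.
    rewrite /= !big_ord_recr/= mulrDr opprD addrACA.
    rewrite [X in _ + X = _](_ : _ = 0) ?addr0; last first.
      have -> : x ^+ k = 2 ^+ k * (x / 2) ^+ k by rewrite -exprMn mulrC divfK.
      by ring.
    rewrite mulr_sumr -sumrB; apply: eq_bigr => j _.
    by rewrite exprMn exprVn; ring.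
  have : a n i * (1 - 2 ^+ k / 2 ^+ i) * (1 - 2 ^+ k / 2 ^+ i)^-1 @[n --> \oo]
      --> (0 * (1 - 2 ^+ k / 2 ^+ i)^-1 : R) by apply: cvgM W (cvg_cst _).
  rewrite mul0r; apply: cvgn_ext => n.
  by rewrite /= mulfK// lt2X.
move=> i; rewrite ltnS leq_eqVlt => /predU1P[->|]; last exact: lower.
(* The top coefficient is isolated by evaluation at 1/2, the lower ones being known to tend to 0. *)
have h01 : 0 < (1 / 2 : R) < 1 by lra.
have S0 : \sum_(i < k) a n i * (1 / 2) ^+ i @[n --> \oo] --> 0.
  rewrite [X in _ --> X](_ : 0 = \sum_(i < k) 0 * (1 / 2) ^+ i); last first.
    by rewrite big1// => j _; rewrite mul0r.
  apply: cvg_big => [z|j _]; first exact: add_continuous.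
  by apply: cvgM (cvg_cst _); exact: lower.
have : (\sum_(i < k.+1) a n i * (1 / 2) ^+ i - \sum_(i < k) a n i * (1 / 2) ^+ i)
    * (1 / 2) ^- k @[n --> \oo] --> ((0 - 0) * (1 / 2) ^- k : R).
  by apply: cvgM (cvg_cst _); exact: cvgB (H _ h01) S0.
rewrite subrr mul0r; apply: cvgn_ext => n.
by rewrite /= big_ord_recr/= addrC addrK mulfK.
Qed.

(* The derivatives of order [< s] of [rounded_bernstein rnd n f] at 0 are
   integers converging to those of [f], hence eventually equal to them; Taylor's
   formula at 0 then transfers the rate from order [s] to order [0]. *)
Lemma rounded_bernstein_rate rnd s f x : (forall a, `|a - (rnd a)%:~R| <= 1) ->
  Cn01 s f ->
  (fun n : nat => supnorm01 (fun x : R =>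
     derivn01 s (rounded_bernstein rnd n f) x - derivn01 s f x))
    =o_\oo (fun n : nat => n%:R^-1 : R) ->
  0 < x < 1 ->
  n%:R * (bernstein n f x - f x) @[n --> \oo] --> 0.
Proof.
move=> hr hf ho x01.
have fc := Cn01_continuous hf.
have W01 (y : R) : 0 < y < 1 -> 0 <= y <= 1 by move=> ?; lra.
have /choice[pz pzP] := fun n => rounded_bernstein_poly rnd n f.
pose p n : {poly R} := map_poly intr (pz n).
have pP n y : rounded_bernstein rnd n f y = (p n).[y] by exact: pzP.
(* The [i]-th derivative of the error, with the formal derivative on the polynomial side. *)
pose D n i (y : R) := (p n)^`(i).[y] - derivn01 i f y.
pose M n := supnorm01 (fun y =>
  derivn01 s (rounded_bernstein rnd n f) y - derivn01 s f y).
have nM (e : R) : 0 < e -> \forall n \near \oo, n%:R * M n <= e.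
  move=> e0; have /eqoP/(_ e e0) := ho.
  move=> H; near=> n.
  have n0 : 0 < n%:R :> R by rewrite ltr0n; near: n; exact: nbhs_infty_gt.
  have : `|M n| <= e * `|n%:R^-1| by near: n; exact: H.
  rewrite normfV (gtr0_norm n0) ler_pdivlMr// mulrC; apply: le_trans.
  by rewrite ler_wpM2l ?ler_norm// ltW.
have DT n (y : R) : 0 <= y <= 1 ->
    `|D n 0%N y - \sum_(i < s) D n i 0 / i`!%:R * y ^+ i| <= M n.
  move=> y01; apply: taylor01 => // [i z iz z01|z z01].
    apply: has_deriv01B; first by rewrite derivnS; exact: has_deriv01_poly.
    by apply: hf.1 => //; rewrite in_itv.
  have derE (t : R) : 0 <= t <= 1 ->
      derivn01 s (rounded_bernstein rnd n f) t = (p n)^`(s).[t].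
    by move=> t01; apply: derivn01_poly => // u _; exact: pP.
  rewrite /D -derE//.
  (* Both terms are bounded on the interval, so [M n] is a true supremum. *)
  have [K1 _ HK1] := continuous01_bounded hf.2.
  have [K2 _ HK2] : exists2 K, 0 < K & forall x, 0 <= x <= 1 ->
      `|(p n)^`(s).[x]| <= K.
    apply: continuous01_bounded; apply: continuous_subspaceT => t.
    exact: continuous_horner.
  have HK t : 0 <= t <= 1 ->
      `|derivn01 s (rounded_bernstein rnd n f) t - derivn01 s f t| <= K2 + K1.
    by move=> t01; rewrite derE// (le_trans (ler_normB _ _))// lerD ?HK1 ?HK2.
  exact: (ler_supnorm01 HK z01).
(* Without any rate, the error of order 0 tends to 0: the Bernstein polynomials converge and the
   rounding error decays. *)
have D0 (y : R) : 0 < y < 1 -> D n 0%N y @[n --> \oo] --> 0.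
  move=> y01.
  have A : rounded_bernstein rnd n f y - bernstein n f y @[n --> \oo] --> 0.
    have /cvgrPdist_le H := rounded_bernstein_cvg f hr y01.
    apply/cvgrPdist_le => e e0; near=> n.
    have n1 : 1 <= n%:R :> R by rewrite ler1n; near: n; exact: nbhs_infty_gt.
    apply: (@le_trans _ _
      `|0 - n%:R * (rounded_bernstein rnd n f y - bernstein n f y)|).
      by rewrite !sub0r !normrN normrM ler_peMl// ger0_norm// (le_trans ler01).
    by near: n; exact: H.
  have : rounded_bernstein rnd n f y - bernstein n f y + bernstein n f y - f y
      @[n --> \oo] --> (0 + f y - f y : R).
    by apply: cvgB (cvg_cst _); exact: cvgD A (bernstein_cvg fc (W01 _ y01)).
  rewrite add0r subrr; apply: cvgn_ext => n.
  by rewrite /D /= subrK pP.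
(* The Taylor polynomial of the error at 0 is within [M n] of the error, so it tends to 0 at
   interior points, hence coefficientwise. *)
have a0 i : (i < s)%N -> D n i 0 / i`!%:R @[n --> \oo] --> 0.
  apply: (@coef_cvg0 s (fun n i => D n i 0 / i`!%:R)) => y y01.
  have := D0 y y01 => /cvgrPdist_le H.
  apply/cvgrPdist_le => e e0; have e20 : 0 < e / 2 by lra.
  near=> n.
  have n1 : 1 <= n%:R :> R by rewrite ler1n; near: n; exact: nbhs_infty_gt.
  have A : `|0 - D n 0%N y| <= e / 2 by near: n; exact: H.
  have B := DT n y (W01 _ y01).
  have Mn0 : 0 <= M n by apply: le_trans B.
  have C : n%:R * M n <= e / 2 by near: n; exact: nM.
  have {}C : M n <= e / 2 by apply: le_trans C; rewrite ler_peMl.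
  set S := \sum_(i < s) _ in B *.
  rewrite (_ : 0 - S = (0 - D n 0%N y) + (D n 0%N y - S)); last by ring.
  by apply: (le_trans (ler_normD _ _)); lra.
(* Only finitely many orders [i < s] are involved, so one rank serves them all. *)
have E : \forall n \near \oo, forall i : 'I_s, D n i 0 = 0.
  apply: filter_forall => i.
  have : (p n)^`(i).[0] @[n --> \oo] --> derivn01 i f 0.
    have : D n i 0 / i`!%:R * i`!%:R + derivn01 i f 0 @[n --> \oo]
        --> (0 * i`!%:R + derivn01 i f 0 : R).
      by apply: cvgD (cvg_cst _); exact: cvgM (a0 i (ltn_ord i)) (cvg_cst _).
    rewrite mul0r add0r; apply: cvgn_ext => n.
    by rewrite /D /= divfK ?subrK// pnatr_eq0 -lt0n fact_gt0.
  have pI n : (p n)^`(i).[0] \is a Num.int.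
    by rewrite /p derivn_map -(rmorph0 intr) horner_map intr_int.
  move=> /(int_cvg_eq pI); apply: filterS => n.
  by rewrite /D => ->; rewrite subrr.
have /cvgrPdist_le H1 := rounded_bernstein_cvg f hr x01.
apply/cvgrPdist_le => e e0; have e20 : 0 < e / 2 by lra.
near=> n.
have A : `|0 - n%:R * (rounded_bernstein rnd n f x - bernstein n f x)| <= e / 2.
  by near: n; exact: H1.
have C : n%:R * M n <= e / 2 by near: n; exact: nM.
(* The Taylor polynomial of the error is now zero, so [M n] bounds the error itself. *)
have : `|D n 0%N x| <= M n.
  have := DT n x (W01 _ x01); rewrite big1 ?subr0// => i _.
  suff -> : D n i 0 = 0 by rewrite !mul0r.
  by move: i; near: n; exact: E.
rewrite /D /= -pP => B.
set r := rounded_bernstein _ _ _ _ in A B.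
rewrite (_ : 0 - _ =
  - (n%:R * (r - f x)) - (0 - n%:R * (r - bernstein n f x))); last by ring.
apply: (le_trans (ler_normB _ _)); rewrite normrN normrM ger0_norm//.
have : n%:R * `|r - f x| <= n%:R * M n by rewrite ler_wpM2l.
by lra.
Unshelve. all: end_near. Qed.
End IntegerCoefficients.

(** * Floor and nearest-integer rounding *)

Section Rounding.
Set Implicit Arguments.
Unset Strict Implicit.
Context {R : realType}.
Implicit Types (f : R -> R) (x : R) (rnd : R -> int).

(** A bound shared by both roundings, which lets a single argument treat them together. *)
Lemma floor_dist_le1 (a : R) : `|a - (Num.floor a)%:~R| <= 1.
Proof.
have /andP[] := floor_itv a; rewrite intrD => l u.
by rewrite ger0_norm ?subr_ge0// lerBlDl ltW.
Qed.

Lemma nearest_integer_dist_le1 rnd (a : R) : nearest_integer rnd ->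
  `|a - (rnd a)%:~R| <= 1.
Proof. by move=> /(_ a (Num.floor a)) /le_trans; apply; exact: floor_dist_le1. Qed.

Lemma nearest_integer_int rnd (m : int) : nearest_integer rnd -> rnd m%:~R = m.
Proof.
move=> /(_ m%:~R m); rewrite subrr normr0 normr_le0 subr_eq0 => /eqP.
by move/intr_inj.
Qed.

(** Rounding is exact here: for [k > 0], [k C(n, k) / n = C(n-1, k-1)], so every coefficient is
    already an integer and the operator reproduces affine functions. *)
Lemma rounded_bernstein_affine rnd n f (p q : int) :
  (forall m : int, rnd m%:~R = m) -> (0 < n)%N ->
  (forall x, 0 <= x <= 1 -> f x = p%:~R * x + q%:~R) ->
  forall x, rounded_bernstein rnd n f x = p%:~R * x + q%:~R.
Proof.
move=> rndK n0 fE x.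
have -> : p%:~R * x + q%:~R = q%:~R + p%:~R * x + 0 * (x ^+ 2 + x * (1 - x) / n%:R).
  by rewrite mul0r addr0 addrC.
rewrite -bernstein_poly2//; apply: eq_bigr => k _.
rewrite fE; last by apply: node01; rewrite -ltnS.
suff /intrP[m mE] : (p%:~R * (k%:R / n%:R) + q%:~R) * 'C(n, k)%:R \is a @Num.int R.
  rewrite mE rndK -mE /bern; ring.
have -> : (p%:~R * (k%:R / n%:R) + q%:~R) * 'C(n, k)%:R
    = p%:~R * (k%:R * 'C(n, k)%:R / n%:R) + q%:~R * 'C(n, k)%:R :> R by ring.
apply: rpredD; last by rewrite rpredM ?intr_int ?rpred_nat.
apply: rpredM; first exact: intr_int.
case: k => -[|k] /= _; first by rewrite !mul0r rpred0.
by rewrite -natrM -mul_bin_diag natrM mulrAC mulfV ?mul1r ?pnatr_eq0 -?lt0n.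
Qed.

Lemma rounded_bernstein_rate_affine rnd s f :
  (forall a, `|a - (rnd a)%:~R| <= 1) -> Cn01 s f ->
  f 0 \is a Num.int -> f 1 \is a Num.int ->
  (fun n : nat => supnorm01 (fun x : R =>
     derivn01 s (rounded_bernstein rnd n f) x - derivn01 s f x))
    =o_\oo (fun n : nat => n%:R^-1 : R) ->
  exists p q : int, forall x, 0 <= x <= 1 -> f x = p%:~R * x + q%:~R.
Proof.
move=> hr hf /intrP[q f0] /intrP[r f1] ho.
exists (r - q), q => x x01.
have fo y : 0 < y < 1 -> n%:R * (bernstein n f y - f y) @[n --> \oo] --> 0.
  by move=> y01; exact: rounded_bernstein_rate ho y01.
rewrite (bernstein_saturation (Cn01_continuous hf) fo x01) f0 f1.
by rewrite intrB addrC.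
Qed.

End Rounding.

Theorem theorem1p4 (R : realType) (rnd : R -> int)
  (hrnd : nearest_integer rnd) (s : nat) (f : R -> R)
  (hf : Cn01 s f) (hf0 : f 0 \is a Num.int) (hf1 : f 1 \is a Num.int)
  (ho :
    (fun n : nat => supnorm01 (fun x : R =>
       derivn01 s (bernstein_floor n f) x - derivn01 s f x))
      =o_\oo (fun n : nat => n%:R^-1 : R)
    \/
    (fun n : nat => supnorm01 (fun x : R =>
       derivn01 s (rounded_bernstein rnd n f) x - derivn01 s f x))
      =o_\oo (fun n : nat => n%:R^-1 : R)) :
  (exists p q : int, forall x : R, x \in `[0, 1] ->
     f x = p%:~R * x + q%:~R) /\
  (forall n : nat, (0 < n)%N -> forall x : R, x \in `[0, 1] ->
     bernstein_floor n f x = f x /\ rounded_bernstein rnd n f x = f x).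
Proof.
have [p [q fE]] : exists p q : int,
    forall x, 0 <= x <= 1 -> f x = p%:~R * x + q%:~R.
  case: ho => ho.
    exact: rounded_bernstein_rate_affine (@floor_dist_le1 R) hf hf0 hf1 ho.
  apply: rounded_bernstein_rate_affine hf hf0 hf1 ho => a.
  exact: nearest_integer_dist_le1.
split; first by exists p, q => x; rewrite in_itv; exact: fE.
move=> n n0 x; rewrite in_itv => x01; rewrite fE//; split.
  by apply: rounded_bernstein_affine => //; exact: intrKfloor.
by apply: rounded_bernstein_affine => // m; exact: nearest_integer_int.
Qed.
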